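(* Every cloud is a proper class (i.e. is not a set): for every non-empty metric space $X$, the cloud $[X]$, consisting of all metric spaces (considered up to zero Gromov--Hausdorff distance) at finite Gromov--Hausdorff distance from $X$, is a proper class.
   Context: We work in von Neumann--Bernays--Gödel set theory, where every object is a class; a set is a class that is an element of some class, and a proper class is a class that is not a set. All metric spaces are non-empty sets. For metric spaces $X,Y$, a correspondence is a surjective multivalued mapping from $X$ to $Y$, identified with its graph: a relation $R\subset X\times Y$ such that every $x\in X$ is related to some $y\in Y$ and every $y\in Y$ is related to some $x\in X$. Its distortion is $\operatorname{dis}R=\sup\{\,||xx'|-|yy'||:(x,y),(x',y')\in R\}$, and the Gromov--Hausdorff distance is $d_{GH}(X,Y)=\frac12\inf\{\operatorname{dis}R\}$ over all correspondences $R$ (possibly $\infty$). $\mathcal{GH}_0$ denotes the class of all non-empty metric spaces, where two spaces are identified if their Gromov--Hausdorff distance is zero. On $\mathcal{GH}_0$ consider the equivalence relation $X\sim Y\Leftrightarrow d_{GH}(X,Y)<\infty$. Its equivalence classes are called clouds; the cloud containing $X$ is denoted $[X]$. *)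

(* Defs.v *)
From Stdlib Require Import Reals.
From Coquelicot Require Import Coquelicot.
Open Scope R_scope.

(* Sets are the types of the universe in which the carriers of Metric_Space
   live; collections of metric spaces live in strictly larger universes and
   play the role of classes. *)
Definition SET := Type@{Metric_Space.u0}.

(* By replacement, a class is a set exactly when its elements are the values
   of a family indexed by a set. *)
Definition is_set {T : Type} (C : T -> Prop) : Prop :=
  exists (S : SET) (f : S -> T), forall t : T, C t <-> exists s : S, f s = t.

Definition proper_class {T : Type} (C : T -> Prop) : Prop := ~ is_set C.

Record MSpace := mkMSpace {
  ms :> Metric_Space;
  ms_nonempty : inhabited (Base ms)
}.

Definition correspondence (X Y : MSpace) (r : Base X -> Base Y -> Prop) : Prop :=
  (forall x, exists y, r x y) /\ (forall y, exists x, r x y).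

Definition dis (X Y : MSpace) (r : Base X -> Base Y -> Prop) : Rbar :=
  Lub_Rbar (fun t : R => exists x x' y y',
    r x y /\ r x' y' /\ t = Rabs (dist X x x' - dist Y y y')).

Definition d_GH (X Y : MSpace) : Rbar :=
  Rbar_mult (Finite (1 / 2))
    (Rbar_glb (fun t : Rbar => exists r, correspondence X Y r /\ t = dis X Y r)).

(* A point of the quotient is represented by the class of all spaces identified
   with a given one. *)
Record GH0 := mkGH0 {
  members : MSpace -> Prop;
  members_spec : exists X : MSpace, members = (fun Y => d_GH X Y = Finite 0)
}.

Definition to_GH0 (X : MSpace) : GH0 :=
  mkGH0 (fun Y => d_GH X Y = Finite 0) (ex_intro _ X eq_refl).

Definition GH_sim (p q : GH0) : Prop :=
  exists X Y : MSpace, members p X /\ members q Y /\ Rbar_lt (d_GH X Y) p_infty.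

Definition cloud (X : MSpace) : GH0 -> Prop := GH_sim (to_GH0 X).

(* Main.v *)
Require Import Defs.
From Stdlib Require Import Reals Lra ClassicalEpsilon Eqdep.
From Coquelicot Require Import Coquelicot.
Open Scope R_scope.

(** Suppose that the cloud of [X] is the range of a family indexed by a set [S],
    and choose a space [Y s] in each of its points.  Let [D] be the power set of
    the disjoint union of the [Y s], with all distances between distinct points
    equal to [1].  The product [D * X] with the max metric is at distance at most
    [1/2] from [X], hence is identified with some [Y s].  A correspondence of
    distortion less than [1] between the two relates distinct points of
    [D * {x0}] to disjoint non-empty subsets of [Y s], contradicting Cantor's
    theorem. *)

Definition discrete_dist (D : Type) (d d' : D) : R :=
  if excluded_middle_informative (d = d') then 0 else 1.

Lemma discrete_dist_refl (D : Type) (d : D) : discrete_dist D d d = 0.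
Proof. unfold discrete_dist; destruct excluded_middle_informative; tauto. Qed.

Lemma discrete_dist_neq (D : Type) (d d' : D) :
  d <> d' -> discrete_dist D d d' = 1.
Proof. unfold discrete_dist; destruct excluded_middle_informative; tauto. Qed.

Lemma discrete_dist_bounds (D : Type) (d d' : D) :
  0 <= discrete_dist D d d' <= 1.
Proof. unfold discrete_dist; destruct excluded_middle_informative; lra. Qed.

Lemma discrete_dist_sym (D : Type) (d d' : D) :
  discrete_dist D d d' = discrete_dist D d' d.
Proof.
unfold discrete_dist; do 2 destruct excluded_middle_informative; congruence.
Qed.

Lemma discrete_dist_tri (D : Type) (d d' e : D) :
  discrete_dist D d d' <= discrete_dist D d e + discrete_dist D e d'.
Proof.
unfold discrete_dist; do 3 destruct excluded_middle_informative;
  try lra; congruence.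
Qed.

Section DiscreteProduct.

Variables (D : SET) (M : Metric_Space).

Definition dprod_dist (p q : D * Base M) : R :=
  Rmax (discrete_dist D (fst p) (fst q)) (dist M (snd p) (snd q)).

Lemma dprod_dist_pos (p q : D * Base M) : dprod_dist p q >= 0.
Proof.
unfold dprod_dist; apply Rle_ge, Rle_trans with (2 := Rmax_r _ _).
apply Rge_le, dist_pos.
Qed.

Lemma dprod_dist_sym (p q : D * Base M) : dprod_dist p q = dprod_dist q p.
Proof.
unfold dprod_dist; rewrite discrete_dist_sym, (dist_sym M); reflexivity.
Qed.

Lemma dprod_dist_refl (p q : D * Base M) : dprod_dist p q = 0 <-> p = q.
Proof.
destruct p as [d x], q as [d' x']; unfold dprod_dist; cbn [fst snd]; split; intros H.
- assert (H1 := Rmax_l (discrete_dist D d d') (dist M x x')).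
  assert (H2 := Rmax_r (discrete_dist D d d') (dist M x x')).
  assert (H3 := dist_pos M x x').
  rewrite H in H1, H2.
  assert (x = x') as -> by (apply (dist_refl M); lra).
  destruct (classic (d = d')) as [-> | n]; [reflexivity|].
  rewrite (discrete_dist_neq D d d' n) in H1; lra.
- injection H as -> ->.
  rewrite discrete_dist_refl, (proj2 (dist_refl M x' x') eq_refl).
  apply Rmax_left; lra.
Qed.

Lemma dprod_dist_tri (p q m : D * Base M) :
  dprod_dist p q <= dprod_dist p m + dprod_dist m q.
Proof.
unfold dprod_dist.
assert (H1 := discrete_dist_tri D (fst p) (fst q) (fst m)).
assert (H2 := dist_tri M (snd p) (snd q) (snd m)).
apply Rmax_lub.
- apply Rle_trans with (1 := H1), Rplus_le_compat; apply Rmax_l.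
- apply Rle_trans with (1 := H2), Rplus_le_compat; apply Rmax_r.
Qed.

Definition dprod_metric : Metric_Space :=
  Build_Metric_Space (D * Base M) dprod_dist
    dprod_dist_pos dprod_dist_sym dprod_dist_refl dprod_dist_tri.

End DiscreteProduct.

Definition dprod (D : SET) (d0 : D) (X : MSpace) : MSpace :=
  mkMSpace (dprod_metric D X)
    (match ms_nonempty X with inhabits x => inhabits (d0, x) end).

Lemma dis_ub (X Y : MSpace) (r : Base X -> Base Y -> Prop) x x' y y' :
  r x y -> r x' y' ->
  Rbar_le (Rabs (dist X x x' - dist Y y y')) (dis X Y r).
Proof.
intros H H'; apply (proj1 (Lub_Rbar_correct _)).
exists x, x', y, y'; auto.
Qed.

Lemma dis_le (X Y : MSpace) (r : Base X -> Base Y -> Prop) (b : R) :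
  (forall x x' y y', r x y -> r x' y' ->
     Rabs (dist X x x' - dist Y y y') <= b) ->
  Rbar_le (dis X Y r) b.
Proof.
intros H; apply (proj2 (Lub_Rbar_correct _)).
intros t (x & x' & y & y' & h & h' & ->); exact (H _ _ _ _ h h').
Qed.

(** A point of the non-empty space [X] and a partner contribute a non-negative term, so the supremum
    is not taken over the empty set, where it would be [m_infty]. *)
Lemma dis_ge0 (X Y : MSpace) (r : Base X -> Base Y -> Prop) :
  correspondence X Y r -> Rbar_le 0 (dis X Y r).
Proof.
intros [Hl _]; destruct (ms_nonempty X) as [x], (Hl x) as [y Hy].
eapply Rbar_le_trans; [|exact (dis_ub X Y r x x y y Hy Hy)].
apply Rabs_pos.
Qed.

Lemma Rbar_glb_correct (E : Rbar -> Prop) : Rbar_is_glb E (Rbar_glb E).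
Proof. exact (proj2_sig (Rbar_ex_glb E)). Qed.

(** A real value [g] serves two purposes: [b = 0] pins the distance down to zero, and [b = 1] yields
    finiteness. *)
Lemma d_GH_le (X Y : MSpace) (r : Base X -> Base Y -> Prop) (b : R) :
  correspondence X Y r ->
  (forall x x' y y', r x y -> r x' y' ->
     Rabs (dist X x x' - dist Y y y') <= b) ->
  exists g : R, d_GH X Y = Finite g /\ 0 <= g <= b / 2.
Proof.
intros Hr Hb; unfold d_GH.
set (E := fun t : Rbar => exists r, correspondence X Y r /\ t = dis X Y r).
destruct (Rbar_glb_correct E) as [Hlb Hglb].
assert (H0 : Rbar_le 0 (Rbar_glb E)).
{ apply Hglb; intros t (r' & Hr' & ->); exact (dis_ge0 X Y r' Hr'). }
assert (H1 : Rbar_le (Rbar_glb E) b).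
{ apply Rbar_le_trans with (dis X Y r); [|apply dis_le, Hb].
  apply Hlb; exists r; auto. }
destruct (Rbar_glb E) as [g| |]; simpl in H0, H1; try contradiction.
exists (1 / 2 * g); split; [reflexivity | lra].
Qed.

Lemma d_GH_refl (X : MSpace) : d_GH X X = Finite 0.
Proof.
destruct (d_GH_le X X eq 0) as (g & -> & Hg).
- split; intros x; exists x; reflexivity.
- intros x x' y y' -> ->; rewrite Rminus_diag, Rabs_R0; apply Rle_refl.
- f_equal; lra.
Qed.

Lemma d_GH_eq0_dis_lt (X Y : MSpace) (b : R) :
  d_GH X Y = Finite 0 -> 0 < b ->
  exists r, correspondence X Y r /\ Rbar_lt (dis X Y r) b.
Proof.
unfold d_GH.
set (E := fun t : Rbar => exists r, correspondence X Y r /\ t = dis X Y r).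
destruct (Rbar_glb_correct E) as [_ Hglb]; intros H0 Hb.
apply NNPP; intros Hn.
assert (H1 : Rbar_le b (Rbar_glb E)).
{ apply Hglb; intros t (r & Hr & ->).
  apply Rbar_not_lt_le; intros Hlt; apply Hn; exists r; auto. }
destruct (Rbar_glb E) as [g| |]; simpl in H1; try contradiction.
- simpl in H0; injection H0; lra.
(* An infinite infimum must be excluded by computation: half of [p_infty] is [p_infty], and the
   convention that zero times infinity is zero does not apply because 1/2 is positive. *)
- unfold Rbar_mult, Rbar_mult' in H0.
  destruct Rle_dec as [h|]; [|lra].
  destruct Rle_lt_or_eq_dec; [discriminate | lra].
Qed.

Lemma d_GH_dprod (D : SET) (d0 : D) (X : MSpace) :
  Rbar_lt (d_GH X (dprod D d0 X)) p_infty.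
Proof.
destruct (d_GH_le X (dprod D d0 X) (fun x p => x = snd p) 1) as (g & -> & _).
- split; [intros x; exists (d0, x); reflexivity | intros p; exists (snd p)].
  reflexivity.
- intros x x' p p' -> ->; simpl; unfold dprod_dist.
  assert (H1 := discrete_dist_bounds D (fst p) (fst p')).
  assert (H2 := dist_pos X (snd p) (snd p')).
  (* Passing from [b >= 0] to the maximum of [a] and [b], with [a] between 0 and 1, adds at most
     1. *)
  apply Rabs_le_between; unfold Rmax; destruct Rle_dec; lra.
- exact I.
Qed.

(** Cantor's diagonal argument. Subsets of the whole disjoint union are used because they must be
    fixed before the index [s] is known. *)
Lemma cantor_family (S : Type) (Y : S -> Type) (s : S)
    (r : ({s : S & Y s} -> Prop) -> Y s -> Prop) :
  (forall d, exists y, r d y) ->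
  exists d d' y, d <> d' /\ r d y /\ r d' y.
Proof.
intros Hr; apply NNPP; intros Hn.
(* [A] collects the points omitted by every subset related to them. A point [y] related to [A]
   cannot lie in [A], so some [d] related to [y] contains it; then [d] differs from [A], and both
   are related to [y]. *)
set (A := fun e : {s : S & Y s} =>
  forall d y, e = existT Y s y -> r d y -> ~ d e).
destruct (Hr A) as [y Hy].
assert (HA : ~ A (existT Y s y)) by (intros H; exact (H A y eq_refl Hy H)).
apply HA; intros d y' e Hd Hde.
apply inj_pair2 in e; subst y'.
apply Hn; exists A, d, y; repeat split; auto.
intros <-; exact (HA Hde).
Qed.

Lemma GH0_representative (p : GH0) :
  exists X : MSpace, members p X.
Proof.
destruct p as [m [X ->]]; exists X; apply d_GH_refl.
Qed.

Theorem theorem1 (X : MSpace) : proper_class (cloud X).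
Proof.
intros (S & f & Hf).
set (Y := fun s => proj1_sig
  (constructive_indefinite_description _ (GH0_representative (f s)))).
assert (HY : forall s, members (f s) (Y s)).
{ intros s; exact (proj2_sig (constructive_indefinite_description _ _)). }
(* Here it matters that the index type [S] is in [SET]: the disjoint union and its power type then
   stay in [SET], so [Z] is again a metric space. The full subset only witnesses non-emptiness. *)
set (Z := dprod ({s : S & Base (Y s)} -> Prop) (fun _ => True) X).
assert (HZ : cloud X (to_GH0 Z)).
{ exists X, Z; split; [apply d_GH_refl | split; [apply d_GH_refl|]].
  apply d_GH_dprod. }
apply Hf in HZ; destruct HZ as [s Hs].
specialize (HY s); rewrite Hs in HY.
destruct (d_GH_eq0_dis_lt Z (Y s) 1 HY Rlt_0_1) as (r & [Hr _] & Hdis).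
destruct (ms_nonempty X) as [x0].
destruct (cantor_family S (fun s => Base (Y s)) s (fun d y => r (d, x0) y))
  as (d & d' & y & n & Hd & Hd').
{ intros d; exact (Hr (d, x0)). }
(* The points [(d, x0)] and [(d', x0)] are at distance 1 but share the partner [y], so the
   distortion is at least 1, against the bound chosen above. *)
assert (H := Rbar_le_lt_trans _ _ _ (dis_ub Z (Y s) r _ _ _ _ Hd Hd') Hdis).
simpl in H; unfold dprod_dist in H; cbn [fst snd] in H.
rewrite (proj2 (dist_refl (Y s) y y) eq_refl), (discrete_dist_neq _ d d' n),
  (proj2 (dist_refl X x0 x0) eq_refl), Rmax_left, Rminus_0_r, Rabs_R1 in H; lra.
Qed.
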